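(* Let $\Omega\subseteq\mathbb{R}^n$ be bounded and measurable, $Y$ a Hilbert space, $S:L^2(\Omega)\to Y$ linear and continuous, $z\in Y$, $u_a,u_b\in L^\infty(\Omega)$, $u_a\le u_b$, $U_{\mathrm{ad}}=\{u\in L^2(\Omega):u_a\le u\le u_b\text{ a.e.}\}$, and let $(S_h)_h$ and $\delta$ be as in the context. Let $u^\dagger$ be a solution of $\min_{u\in U_{\mathrm{ad}}}\frac12\|Su-z\|_Y^2$ satisfying the source condition: there exists $w\in Y$ with $u^\dagger=P_{U_{\mathrm{ad}}}(S^\ast w)$. Let $(\varepsilon_k)_k$ be a sequence of positive real numbers, let $h>0$ be given, and let $(u_k^{\mathrm{in}})_k$ be a sequence generated by the inexact Bregman algorithm described in the context. Then there is a constant $c>0$ (independent of $k$) such that for all $k$ \[\sum_{i=1}^k\frac1{\alpha_i}\|u_i^{\mathrm{in}}-u^\dagger\|^2\le c\Big(1+\sum_{i=1}^kR_i+\sum_{i=1}^kH_i\Big),\] where \[R_i:=\frac{\varepsilon_i}{\alpha_i}+\frac{\varepsilon_i^2}{\alpha_i^2}+\frac{\gamma_{i-1}\varepsilon_i}{\alpha_i}+\frac{\varepsilon_i^2}{\alpha_i},\qquad H_i:=\delta(h)\Big[\frac{\rho_i}{\alpha_i}+\frac{\gamma_{i-1}}{\alpha_i}+\frac{\gamma_{i-1}\rho_i}{\alpha_i}\Big]+\delta(h)^2\Big[\frac{\rho_i^2}{\alpha_i^2}+\frac{\rho_i^2}{\alpha_i}\Big].\]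
   Context: $\|\cdot\|,(\cdot,\cdot)$: norm and inner product of $L^2(\Omega)$; $P_{U_{\mathrm{ad}}}$: $L^2$-projection onto $U_{\mathrm{ad}}$; $S^\ast$ adjoint. Discretization: for each $h$, $S_h:L^2(\Omega)\to Y$ is linear continuous with finite-dimensional range, and there is a continuous, monotonically increasing $\delta:\mathbb{R}^+\to\mathbb{R}^+$, $\delta(0)=0$, with $\|(S-S_h)u_h\|_Y+\|(S^\ast-S_h^\ast)(S_hu_h-z)\|\le\delta(h)$ for all $h\ge0$, $u_h\in U_{\mathrm{ad}}$. $(\alpha_k)_k$ is a bounded sequence of positive reals, $\gamma_k:=\sum_{j=1}^k\alpha_j^{-1}$ ($\gamma_0=0$), $\rho_k:=\sqrt{\alpha_k^{-1}(1+\alpha_k^{-1})}$. Define $\mathcal B(\alpha,\lambda,u):=(1+\frac1\alpha)\|u-P_{U_{\mathrm{ad}}}(\frac1\alpha S_h^\ast(z-S_hu)+\lambda)\|$. Inexact Bregman algorithm: $u_0^{\mathrm{in}}=P_{U_{\mathrm{ad}}}(0)$, $\lambda_0^{\mathrm{in}}=0$; for $k=1,2,\dots$ find $u_k^{\mathrm{in}}\in U_{\mathrm{ad}}$ with $\mathcal B(\alpha_k,\lambda_{k-1}^{\mathrm{in}},u_k^{\mathrm{in}})\le\varepsilon_k$, then set $\lambda_k^{\mathrm{in}}=\sum_{i=1}^k\frac1{\alpha_i}S_h^\ast(z-S_hu_i^{\mathrm{in}})$. *)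

(* Defs.v *)
From HB Require Import structures.
From mathcomp Require Import all_boot all_order all_algebra.
From mathcomp Require Import all_classical all_reals all_analysis.
Set Implicit Arguments.
Unset Strict Implicit.
Unset Printing Implicit Defensive.
Import Order.TTheory GRing.Theory Num.Theory.
Import numFieldNormedType.Exports.
Local Open Scope classical_set_scope.
Local Open Scope ring_scope.

Section L2Omega.
(* Elements of L^2(Omega) are represented by functions T -> R; only their
   values on Omega matter, and functions equal a.e. on Omega have the same
   L^2 norm / inner product. *)
Context {d : measure_display} {T : measurableType d} {R : realType}.
Variables (mu : {measure set T -> \bar R}) (Omega : set T).

Definition L2 (f : T -> R) : Prop :=
  measurable_fun Omega f /\ mu.-integrable Omega (fun x => ((f x) ^+ 2)%:E).

Definition ip2 (f g : T -> R) : R := Rintegral mu Omega (fun x => f x * g x).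
Definition nrm2 (f : T -> R) : R := Num.sqrt (Rintegral mu Omega (fun x => (f x) ^+ 2)).

Definition Linf (f : T -> R) : Prop :=
  measurable_fun Omega f /\
  exists M : R, {ae mu, forall x, Omega x -> `|f x| <= M}.

Definition Uad (ua ub : T -> R) (u : T -> R) : Prop :=
  L2 u /\ {ae mu, forall x, Omega x -> ua x <= u x <= ub x}.

Definition is_L2proj (U : (T -> R) -> Prop) (P : (T -> R) -> (T -> R)) : Prop :=
  forall v, L2 v -> U (P v) /\
    forall q, U q -> nrm2 (fun x => v x - P v x) <= nrm2 (fun x => v x - q x).

Definition lin_cont {Y : normedModType R} (A : (T -> R) -> Y) : Prop :=
  (forall (a : R) f g, L2 f -> L2 g ->
     A (fun x => a * f x + g x) = a *: A f + A g) /\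
  (exists C : R, forall f, L2 f -> `|A f| <= C * nrm2 f).

Definition finite_range {Y : normedModType R} (A : (T -> R) -> Y) : Prop :=
  exists (m : nat) (e : 'I_m -> Y), forall f, L2 f ->
    exists c : 'I_m -> R, A f = \sum_(i < m) c i *: e i.

Definition is_adjoint {Y : normedModType R} (ipY : Y -> Y -> R)
  (A : (T -> R) -> Y) (Astar : Y -> (T -> R)) : Prop :=
  forall y, L2 (Astar y) /\ forall u, L2 u -> ip2 (Astar y) u = ipY (A u) y.

End L2Omega.

(* ipY is an inner product on the normed space Y inducing its norm;
   together with completeness of Y this makes Y a real Hilbert space *)
Definition inner_product_of {R : realType} {Y : normedModType R}
  (ipY : Y -> Y -> R) : Prop :=
  (forall x y, ipY x y = ipY y x) /\
  (forall (a : R) x y z, ipY (a *: x + y) z = a * ipY x z + ipY y z) /\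
  (forall x, ipY x x = `|x| ^+ 2).

Definition gam {R : realType} (alpha : nat -> R) (k : nat) : R :=
  \sum_(1 <= j < k.+1) (alpha j)^-1.

Definition rho {R : realType} (alpha : nat -> R) (k : nat) : R :=
  Num.sqrt ((alpha k)^-1 * (1 + (alpha k)^-1)).

Definition Rterm {R : realType} (alpha eps : nat -> R) (i : nat) : R :=
  eps i / alpha i + (eps i) ^+ 2 / (alpha i) ^+ 2
  + gam alpha i.-1 * eps i / alpha i + (eps i) ^+ 2 / alpha i.

Definition Hterm {R : realType} (alpha : nat -> R) (dh : R) (i : nat) : R :=
  dh * (rho alpha i / alpha i + gam alpha i.-1 / alpha i
        + gam alpha i.-1 * rho alpha i / alpha i)
  + dh ^+ 2 * ((rho alpha i) ^+ 2 / (alpha i) ^+ 2 + (rho alpha i) ^+ 2 / alpha i).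

Section Bregman.
Context {d : measure_display} {T : measurableType d} {R : realType}.
Context {Y : normedModType R}.
Variables (mu : {measure set T -> \bar R}) (Omega : set T).
Variables (P : (T -> R) -> (T -> R)) (Sh : (T -> R) -> Y) (Shstar : Y -> (T -> R))
  (z : Y).

Definition Bres (a : R) (lam u : T -> R) : R :=
  (1 + a^-1) *
  nrm2 mu Omega (fun x => u x - P (fun y => a^-1 * Shstar (z - Sh u) y + lam y) x).

Definition lam_in (alpha : nat -> R) (u : nat -> T -> R) (k : nat) : T -> R :=
  fun x => \sum_(1 <= i < k.+1) (alpha i)^-1 * Shstar (z - Sh (u i)) x.

Definition inexact_bregman (U : (T -> R) -> Prop) (alpha eps : nat -> R)
  (u : nat -> T -> R) : Prop :=
  u 0%N = P (fun _ => 0) /\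
  forall k, (0 < k)%N ->
    U (u k) /\ Bres (alpha k) (lam_in alpha u k.-1) (u k) <= eps k.

End Bregman.

(* Main.v *)
Require Import Defs.
From HB Require Import structures.
From mathcomp Require Import all_boot all_order all_algebra.
From mathcomp Require Import all_classical all_reals all_analysis.
From mathcomp Require Import ring lra measurable_realfun.
Import Order.TTheory GRing.Theory Num.Theory.
Import numFieldNormedType.Exports.
Local Open Scope classical_set_scope.
Local Open Scope ring_scope.

(* Write u^dag = P (S^* w) (source condition) and let
   lambda_k = S_h^* mu_k with mu_k = sum_(i <= k) alpha_i^-1 (z - S_h u_i), so that
   u_k is an inexact projection of lambda_k.  The variational inequalities of the
   projections P lambda_k and P (S^* w), together with the first-order optimality of
   u^dag, bound || P lambda_k - u^dag ||^2 by inner products in Y.  Splitting mu_k into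
   gamma_k (z - S u^dag), the accumulated images S u_i - S u^dag and the discretisation
   errors S_h u_i - S u_i leaves the telescoping quantity
   c_k = w + sum_(i <= k) alpha_i^-1 (S u_i - S u^dag), since
   ||c_k||^2 - ||c_(k-1)||^2 <= 2 alpha_k^-1 (S u_k - S u^dag, c_k).
   Boundedness of U_ad turns every remaining term into a multiple of R_k or H_k. *)

Set Implicit Arguments.
Unset Strict Implicit.

Lemma first_order_min {R : realFieldType} (a b : R) :
  (forall t, 0 < t -> t <= 1 -> 0 <= 2 * t * a + t ^+ 2 * b) -> 0 <= a.
Proof.
move=> H; rewrite leNgt; apply/negP => a_lt0.
have nb_ge0 := normr_ge0 b.
set t := - a / (`|b| - a).
have t_gt0 : 0 < t by rewrite divr_gt0; lra.
have t_le1 : t <= 1 by rewrite ler_pdivrMr; lra.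
have tb_le : t * `|b| <= - a by rewrite mulrAC ler_pdivrMr; nra.
have t2b : t ^+ 2 * b <= t * (t * `|b|).
  by rewrite mulrA -expr2; apply: ler_wpM2l; rewrite ?sqr_ge0 ?ler_norm.
have := ler_wpM2l (ltW t_gt0) tb_le.
have : t * a < 0 by rewrite pmulr_rlt0.
have := H t t_gt0 t_le1; lra.
Qed.

Section L2_algebra.
Context {d : measure_display} {T : measurableType d} {R : realType}.
Variables (mu : {measure set T -> \bar R}) (Omega : set T).
Hypothesis mOmega : measurable Omega.

Local Notation L2 := (L2 mu Omega).
Local Notation ip := (ip2 mu Omega).
Local Notation nrm := (nrm2 mu Omega).

Lemma L2_integrable_mul f g : L2 f -> L2 g ->
  mu.-integrable Omega (EFin \o (fun x => f x * g x)).
Proof.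
move=> [mf iff] [mg igg].
apply: (le_integrable mOmega _ _ (integrableD mOmega iff igg)).
- by apply/measurable_EFinP; apply: measurable_funM.
- move=> x _ /=; rewrite lee_fin normrM.
  rewrite (ger0_norm (addr_ge0 (sqr_ge0 _) (sqr_ge0 _))).
  rewrite -(real_normK (num_real (f x))) -(real_normK (num_real (g x))).
  by have := sqr_ge0 (`|f x| - `|g x|); nra.
Qed.

Lemma L2_lin (a : R) f g : L2 f -> L2 g -> L2 (fun x => a * f x + g x).
Proof.
move=> [mf iff] [mg igg]; split.
  by apply: measurable_funD => //; apply: measurable_funM.
have iF := integrableD mOmega (integrableZl mOmega (2 * a ^+ 2) iff)
  (integrableZl mOmega 2 igg).
apply: (le_integrable mOmega _ _ iF).
- apply/measurable_EFinP; apply: measurable_funX.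
  by apply: measurable_funD => //; apply: measurable_funM.
- move=> x _ /=; rewrite lee_fin ger0_norm ?sqr_ge0 // ger0_norm; last first.
    by rewrite addr_ge0 // mulr_ge0 // ?sqr_ge0 // mulr_ge0 // sqr_ge0.
  by have := sqr_ge0 (a * f x - g x); nra.
Qed.

Lemma L2B f g : L2 f -> L2 g -> L2 (fun x => f x - g x).
Proof.
move=> Lf Lg; have := L2_lin (-1) Lg Lf.
by congr L2; apply: funext => x; rewrite mulN1r addrC.
Qed.

Lemma ip2C f g : ip f g = ip g f.
Proof. by apply: eq_Rintegral => x _; rewrite mulrC. Qed.

Lemma ip2_linl (a : R) f g h : L2 f -> L2 g -> L2 h ->
  ip (fun x => a * f x + g x) h = a * ip f h + ip g h.
Proof.
move=> Lf Lg Lh; have ifh := L2_integrable_mul Lf Lh.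
rewrite /ip2 -RintegralZl // -RintegralD //; last first.
- exact: L2_integrable_mul.
- apply: (eq_integrable mOmega _ _ _ (integrableZl mOmega a ifh)).
  by move=> x _ /=; rewrite EFinM.
by apply: eq_Rintegral => x _; rewrite mulrDl mulrA.
Qed.

Lemma ip2Bl f g h : L2 f -> L2 g -> L2 h ->
  ip (fun x => f x - g x) h = ip f h - ip g h.
Proof.
move=> Lf Lg Lh; have := ip2_linl (-1) Lg Lf Lh.
have -> : (fun x => -1 * g x + f x) = (fun x => f x - g x).
  by apply: funext => x; rewrite mulN1r addrC.
by move=> ->; ring.
Qed.

Lemma ip2Br f g h : L2 f -> L2 g -> L2 h ->
  ip h (fun x => f x - g x) = ip h f - ip h g.
Proof. by move=> Lf Lg Lh; rewrite ip2C ip2Bl // (ip2C f) (ip2C g). Qed.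

Lemma nrm2_ge0 f : 0 <= nrm f.
Proof. exact: sqrtr_ge0. Qed.

Lemma nrm2_sq f : nrm f ^+ 2 = ip f f.
Proof.
rewrite sqr_sqrtr; last by apply: Rintegral_ge0 => x _; exact: sqr_ge0.
by apply: eq_Rintegral => x _; rewrite expr2.
Qed.

Lemma ip2_sub_sym f g : L2 f -> L2 g ->
  ip f (fun x => g x - f x) + ip g (fun x => f x - g x) = - nrm (fun x => f x - g x) ^+ 2.
Proof.
move=> Lf Lg; rewrite nrm2_sq ip2Bl //; last exact: L2B.
by rewrite !ip2Br // (ip2C g f); ring.
Qed.

Lemma nrm2_addZ_sq (t : R) f g : L2 f -> L2 g ->
  nrm (fun x => f x + t * g x) ^+ 2 = nrm f ^+ 2 + 2 * t * ip f g + t ^+ 2 * nrm g ^+ 2.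
Proof.
move=> Lf Lg; have -> : (fun x => f x + t * g x) = (fun x => t * g x + f x).
  by apply: funext => x; rewrite addrC.
have Lfg := L2_lin t Lg Lf.
rewrite !nrm2_sq ip2_linl // ip2C ip2_linl // ip2C (ip2C f) ip2_linl //; ring.
Qed.

Lemma nrm2_add_sq_le f g : L2 f -> L2 g ->
  nrm (fun x => f x + g x) ^+ 2 <= 2 * nrm f ^+ 2 + 2 * nrm g ^+ 2.
Proof.
move=> Lf Lg; have := nrm2_addZ_sq 1 Lf Lg; have := nrm2_addZ_sq (-1) Lf Lg.
have := sqr_ge0 (nrm (fun x => f x + -1 * g x)).
have -> : (fun x => f x + 1 * g x) = (fun x => f x + g x).
  by apply: funext => x; rewrite mul1r.
lra.
Qed.

Lemma Rintegral_ae_eq F G : measurable_fun Omega F -> measurable_fun Omega G ->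
  {ae mu, forall x, Omega x -> F x = G x} ->
  Rintegral mu Omega F = Rintegral mu Omega G.
Proof.
move=> mF mG FG; congr fine; apply: ae_eq_integral => //; try exact/measurable_EFinP.
by move: FG; apply: filterS => x FGx /FGx /= ->.
Qed.

Lemma nrm2_ae_eq f g : measurable_fun Omega f -> measurable_fun Omega g ->
  {ae mu, forall x, Omega x -> f x = g x} -> nrm f = nrm g.
Proof.
move=> mf mg fg; congr Num.sqrt; apply: Rintegral_ae_eq; try exact: measurable_funX.
by move: fg; apply: filterS => x fgx /fgx ->.
Qed.

End L2_algebra.

Section inner_product.
Context {R : realType} {Y : normedModType R} (ip : Y -> Y -> R).
Hypothesis hip : inner_product_of ip.

Lemma ipYC x y : ip x y = ip y x.
Proof. by case: hip. Qed.

Lemma ipY_linl (a : R) x y z : ip (a *: x + y) z = a * ip x z + ip y z.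
Proof. by case: hip => _ []. Qed.

Lemma ipY_norm x : ip x x = `|x| ^+ 2.
Proof. by case: hip => _ []. Qed.

Lemma ipY0l z : ip 0 z = 0.
Proof. by have := ipY_linl 1 0 0 z; rewrite scaler0 addr0 mul1r; lra. Qed.

Lemma ipYZl (a : R) x z : ip (a *: x) z = a * ip x z.
Proof. by rewrite -[a *: x]addr0 ipY_linl ipY0l addr0. Qed.

Lemma ipYDl x y z : ip (x + y) z = ip x z + ip y z.
Proof. by rewrite -[x in LHS]scale1r ipY_linl mul1r. Qed.

Lemma ipYNl x z : ip (- x) z = - ip x z.
Proof. by rewrite -scaleN1r ipYZl mulN1r. Qed.

Lemma ipYBl x y z : ip (x - y) z = ip x z - ip y z.
Proof. by rewrite ipYDl ipYNl. Qed.

Lemma ipYZr (a : R) x z : ip z (a *: x) = a * ip z x.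
Proof. by rewrite ipYC ipYZl ipYC. Qed.

Lemma ipYDr x y z : ip z (x + y) = ip z x + ip z y.
Proof. by rewrite ipYC ipYDl !(ipYC z). Qed.

Lemma ipYBr x y z : ip z (x - y) = ip z x - ip z y.
Proof. by rewrite ipYC ipYBl !(ipYC z). Qed.

Lemma normDZ_sq (t : R) x y :
  `|x + t *: y| ^+ 2 = `|x| ^+ 2 + 2 * t * ip x y + t ^+ 2 * `|y| ^+ 2.
Proof. by rewrite -!ipY_norm ipYDl !ipYDr !ipYZl !ipYZr (ipYC y x); ring. Qed.

Lemma ipY_le_norm x y : ip x y <= `|x| * `|y|.
Proof.
have [-> | x_neq0] := eqVneq x 0; first by rewrite ipY0l normr0 mul0r.
have [-> | y_neq0] := eqVneq y 0; first by rewrite ipYC ipY0l normr0 mulr0.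
have nx_gt0 : 0 < `|x| by rewrite normr_gt0.
have ny_gt0 : 0 < `|y| by rewrite normr_gt0.
have := sqr_ge0 (Num.norm (`|y| *: x - `|x| *: y)).
rewrite -ipY_norm !(ipYBl, ipYBr, ipYZl, ipYZr) (ipYC y x) !ipY_norm => H.
have : 0 <= `|x| * `|y| * (2 * (`|x| * `|y| - ip x y)).
  by move: H; congr (_ <= _); ring.
by rewrite pmulr_rge0 ?mulr_gt0 //; lra.
Qed.

Lemma ipY_ge_norm x y : - (`|x| * `|y|) <= ip x y.
Proof.
have := ipY_le_norm x (- y).
by rewrite -scaleN1r ipYZr normrZ normrN1 mul1r; lra.
Qed.

Lemma normDZ_sq_le (a : R) c e :
  `|c + a *: e| ^+ 2 - `|c| ^+ 2 <= 2 * a * ip e (c + a *: e).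
Proof.
rewrite normDZ_sq ipYDr ipYZr ipY_norm (ipYC c e).
by have := sqr_ge0 (a * `|e|); rewrite exprMn; lra.
Qed.

End inner_product.

Definition is_convex {T : Type} {R : realType} (U : (T -> R) -> Prop) : Prop :=
  forall p q (t : R), U p -> U q -> 0 <= t -> t <= 1 ->
    U (fun x => p x + t * (q x - p x)).

Section operators_and_projections.
Context {d : measure_display} {T : measurableType d} {R : realType}.
Context {Y : normedModType R}.
Variables (mu : {measure set T -> \bar R}) (Omega : set T).
Hypothesis mOmega : measurable Omega.

Local Notation L2 := (L2 mu Omega).
Local Notation ip := (ip2 mu Omega).
Local Notation nrm := (nrm2 mu Omega).

Lemma linB (A : (T -> R) -> Y) f g : lin_cont mu Omega A -> L2 f -> L2 g ->
  A (fun x => f x - g x) = A f - A g.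
Proof.
move=> [linA _] Lf Lg; have := linA (-1) g f Lg Lf.
rewrite scaleN1r addrC => <-; congr A; apply: funext => x; ring.
Qed.

Lemma lin_segment (A : (T -> R) -> Y) p q (t : R) : lin_cont mu Omega A ->
  L2 p -> L2 q -> A (fun x => p x + t * (q x - p x)) = A p + t *: (A q - A p).
Proof.
move=> hA Lp Lq; have [linA _] := hA.
rewrite -(linB hA Lq Lp) addrC -linA //; last exact: L2B.
by congr A; apply: funext => x; rewrite addrC.
Qed.

Lemma lin_cont_bound (A : (T -> R) -> Y) : lin_cont mu Omega A ->
  exists C, 0 <= C /\ forall f, L2 f -> `|A f| <= C * nrm f.
Proof.
move=> [_ [C HC]]; exists `|C|; split => // f Lf.
by apply: (le_trans (HC f Lf)); apply: ler_wpM2r; rewrite ?nrm2_ge0 ?ler_norm.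
Qed.

Lemma lin_cont_ae_eq (A : (T -> R) -> Y) f g : lin_cont mu Omega A ->
  L2 f -> L2 g -> {ae mu, forall x, Omega x -> f x = g x} -> A f = A g.
Proof.
move=> hA Lf Lg fg; have [C [C_ge0 A_le]] := lin_cont_bound hA.
have nrm_fg : nrm (fun x => f x - g x) = 0.
  rewrite (@nrm2_ae_eq _ _ _ _ _ mOmega _ (fun _ => 0)).
  - by rewrite /nrm2 Rintegral_cst // expr0n mul0r sqrtr0.
  - by case: (L2B mOmega Lf Lg).
  - exact: measurable_cst.
  - by move: fg; apply: filterS => x fgx /fgx ->; rewrite subrr.
apply/eqP; rewrite -subr_eq0 -normr_eq0 eq_le normr_ge0 andbT -linB //.
by rewrite (le_trans (A_le _ (L2B mOmega Lf Lg))) // nrm_fg mulr0.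
Qed.

Lemma L2proj_variational_ineq U P : is_L2proj mu Omega U P ->
  (forall q, U q -> L2 q) -> is_convex U ->
  forall v q, L2 v -> U q -> ip (fun x => v x - P v x) (fun x => q x - P v x) <= 0.
Proof.
move=> hP UL2 convU v q Lv Uq; have [UPv Pv_min] := hP v Lv.
have Lvp : L2 (fun x => v x - P v x) by apply: L2B => //; exact: UL2.
have Lqp : L2 (fun x => q x - P v x) by apply: L2B => //; exact: UL2.
rewrite -oppr_ge0; apply: (first_order_min (b := nrm (fun x => q x - P v x) ^+ 2)).
move=> t t_gt0 t_le1.
have := Pv_min _ (convU _ _ t UPv Uq (ltW t_gt0) t_le1).
have -> : (fun x => v x - (P v x + t * (q x - P v x))) =
    (fun x => (v x - P v x) + (- t) * (q x - P v x)).
  by apply: funext => x; ring.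
move=> /(lerXn2r 2 (nrm2_ge0 _ _ _) (nrm2_ge0 _ _ _)).
rewrite nrm2_addZ_sq // sqrrN; lra.
Qed.

Lemma min_variational_ineq (S : (T -> R) -> Y) U x0 z (ipY : Y -> Y -> R) :
  inner_product_of ipY -> lin_cont mu Omega S ->
  (forall q, U q -> L2 q) -> is_convex U -> U x0 ->
  (forall v, U v -> `|S x0 - z| ^+ 2 <= `|S v - z| ^+ 2) ->
  forall q, U q -> ipY (S q - S x0) (z - S x0) <= 0.
Proof.
move=> hipY hS UL2 convU Ux0 x0_min q Uq.
rewrite -(opprB (S x0) z) (ipYC hipY) (ipYNl hipY) oppr_le0.
apply: (first_order_min (b := `|S q - S x0| ^+ 2)) => t t_gt0 t_le1.
have := x0_min _ (convU _ _ t Ux0 Uq (ltW t_gt0) t_le1).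
rewrite (lin_segment t hS (UL2 _ Ux0) (UL2 _ Uq)) addrAC (normDZ_sq hipY); lra.
Qed.

End operators_and_projections.

Section admissible_set.
Context {d : measure_display} {T : measurableType d} {R : realType}.
Variables (mu : {measure set T -> \bar R}) (Omega : set T).
Hypothesis mOmega : measurable Omega.
Variables ua ub : T -> R.

Local Notation Uad := (Uad mu Omega ua ub).

Lemma Uad_convex : is_convex Uad.
Proof.
move=> p q t [Lp Hp] [Lq Hq] t_ge0 t_le1; split.
  have := L2_lin mOmega t (L2B mOmega Lq Lp) Lp.
  by congr L2; apply: funext => x; rewrite addrC.
move: Hp Hq; apply: filterS2 => x Hpx Hqx Ox.
have /andP[pa pb] := Hpx Ox; have /andP[qa qb] := Hqx Ox.
by apply/andP; split; nra.
Qed.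

Lemma Uad_bounded : Linf mu Omega ua -> Linf mu Omega ub -> (mu Omega < +oo)%E ->
  exists B, 0 <= B /\ forall u, Uad u -> nrm2 mu Omega u <= B.
Proof.
move=> [_ [Ma Ha]] [_ [Mb Hb]] Omega_fin.
set M := `|Ma| + `|Mb|.
have mOmega_fin : mu Omega \is a fin_num by rewrite ge0_fin_numE.
exists (Num.sqrt (M ^+ 2 * fine (mu Omega))); split; first exact: sqrtr_ge0.
move=> u [[mfu iu] Hu]; apply: ler_wsqrtr.
rewrite /Rintegral -lee_fin fineK; last exact: integrable_fin_num iu.
apply: (@le_trans _ _ (\int[mu]_(x in Omega) (M ^+ 2)%:E)%E); last first.
  by rewrite integral_cst // -[X in (_ * X)%E](fineK mOmega_fin).
apply: ae_ge0_le_integral => //.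
- by move=> x _; rewrite lee_fin sqr_ge0.
- by apply/measurable_EFinP; apply: measurable_funX.
- by move=> x _; rewrite lee_fin sqr_ge0.
move: Ha Hb Hu; apply: filterS3 => x Hax Hbx Hux Ox.
have /andP[ua_u u_ub] := Hux Ox.
move: (Hax Ox) (Hbx Ox); rewrite !ler_norml => /andP[? ?] /andP[? ?].
have M_ge0 : 0 <= M by rewrite addr_ge0.
rewrite lee_fin -(real_normK (num_real (u x))) lerXn2r ?nnegrE //.
rewrite ler_norml; have := ler_norm Ma; have := ler_norm Mb.
have := normr_ge0 Ma; have := normr_ge0 Mb; rewrite /M; lra.
Qed.

End admissible_set.

Section step_sizes.
Context {R : realType}.
Variable alpha : nat -> R.
Hypothesis alpha_gt0 : forall k, (0 < k)%N -> 0 < alpha k.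

Lemma sum_ge0 (F : nat -> R) k : (forall i, (0 < i)%N -> 0 <= F i) ->
  0 <= \sum_(1 <= i < k.+1) F i.
Proof.
by move=> F_ge0; rewrite big_nat_cond; apply: sumr_ge0 => i /andP[/andP[/F_ge0]].
Qed.

Lemma gamS k : gam alpha k.+1 = gam alpha k + (alpha k.+1)^-1.
Proof. by rewrite /gam big_nat_recr. Qed.

Lemma gam_ge0 k : 0 <= gam alpha k.
Proof.
rewrite /gam big_nat_cond; apply: sumr_ge0 => i /andP[/andP[i_gt0 _] _].
by rewrite invr_ge0 ltW ?alpha_gt0.
Qed.

Lemma inv_le_rho k : 0 < alpha k -> (alpha k)^-1 <= rho alpha k.
Proof.
move=> ak_gt0; have a_gt0 : 0 < (alpha k)^-1 by rewrite invr_gt0.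
rewrite -(ger0_norm (ltW a_gt0)) -sqrtr_sqr; apply: ler_wsqrtr; nra.
Qed.

Lemma norm_sum_le_gam {Y : normedModType R} (F : nat -> Y) (X : R) k :
  (forall i, (0 < i)%N -> `|F i| <= X) ->
  `|\sum_(1 <= i < k.+1) (alpha i)^-1 *: F i| <= gam alpha k * X.
Proof.
move=> F_le; rewrite /gam mulr_suml.
apply: (le_trans (ler_norm_sum _ _ _)); apply: ler_sum_nat => i /andP[i_gt0 _].
rewrite normrZ gtr0_norm ?invr_gt0 ?alpha_gt0 //.
by apply: ler_wpM2l; [rewrite invr_ge0 ltW ?alpha_gt0 | exact: F_le].
Qed.

Lemma Rterm_ge0 eps i : (0 < i)%N -> 0 <= eps i -> 0 <= Rterm alpha eps i.
Proof.
move=> i_gt0 e_ge0; have a_ge0 : 0 <= alpha i by rewrite ltW ?alpha_gt0.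
have g_ge0 := gam_ge0 i.-1.
by rewrite /Rterm !addr_ge0 ?divr_ge0 ?mulr_ge0 ?exprn_ge0.
Qed.

Lemma Hterm_ge0 dl i : (0 < i)%N -> 0 <= dl -> 0 <= Hterm alpha dl i.
Proof.
move=> i_gt0 dl_ge0; have a_ge0 : 0 <= alpha i by rewrite ltW ?alpha_gt0.
have g_ge0 := gam_ge0 i.-1; have r_ge0 : 0 <= rho alpha i := sqrtr_ge0 _.
by rewrite /Hterm !addr_ge0 ?mulr_ge0 ?addr_ge0 ?divr_ge0 ?mulr_ge0 ?exprn_ge0.
Qed.

Lemma Hterm_ge dl k : 0 <= dl ->
  (alpha k.+1)^-1 * gam alpha k.+1 * dl <= Hterm alpha dl k.+1.
Proof.
move=> dl_ge0; set a := (alpha k.+1)^-1.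
have a_ge0 : 0 <= a by rewrite invr_ge0 ltW ?alpha_gt0.
have g_ge0 := gam_ge0 k; have r_ge0 : 0 <= rho alpha k.+1 := sqrtr_ge0 _.
have a_le_r : a <= rho alpha k.+1 by apply: inv_le_rho; apply: alpha_gt0.
have : 0 <= dl * (gam alpha k * rho alpha k.+1 * a) by rewrite !mulr_ge0.
have : 0 <= dl ^+ 2 * (rho alpha k.+1 ^+ 2 / alpha k.+1 ^+ 2 + rho alpha k.+1 ^+ 2 * a).
  by rewrite mulr_ge0 ?sqr_ge0 // -exprVn -/a addr_ge0 // mulr_ge0 ?sqr_ge0.
have := ler_wpM2l (mulr_ge0 dl_ge0 a_ge0) a_le_r.
rewrite /Hterm gamS -/a /=; nra.
Qed.

Lemma Rterm_ge eps k (eta : R) : 0 <= eta ->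
  (1 + (alpha k.+1)^-1) * eta <= eps k.+1 ->
  [/\ (alpha k.+1)^-1 * eta <= Rterm alpha eps k.+1,
      (alpha k.+1)^-1 * gam alpha k.+1 * eta <= Rterm alpha eps k.+1
    & (alpha k.+1)^-1 * eta ^+ 2 <= Rterm alpha eps k.+1].
Proof.
move=> eta_ge0 eta_le; set a := (alpha k.+1)^-1.
have a_ge0 : 0 <= a by rewrite invr_ge0 ltW ?alpha_gt0.
have e2_ge0 : 0 <= eps k.+1 ^+ 2 / alpha k.+1 ^+ 2 by rewrite divr_ge0 ?sqr_ge0.
rewrite /Rterm gamS /= -/a in e2_ge0 eta_le *; clearbody a.
have g_ge0 := gam_ge0 k.
have a_eta_ge0 := mulr_ge0 a_ge0 eta_ge0.
have eta_le_e : eta <= eps k.+1 by lra.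
have e_ge0 : 0 <= eps k.+1 by lra.
have := ler_wpM2l a_ge0 eta_le_e; have := ler_wpM2l g_ge0 (ler_wpM2l a_ge0 eta_le_e).
have eta2_le : eta ^+ 2 <= eps k.+1 ^+ 2 by rewrite lerXn2r ?nnegrE.
have := ler_wpM2l a_ge0 eta2_le.
split; nra.
Qed.

End step_sizes.

Section inexact_Bregman_estimate.
Context {d : measure_display} {T : measurableType d} {R : realType}.
Context {Y : normedModType R}.
Variables (mu : {measure set T -> \bar R}) (Omega : set T).
Hypothesis mOmega : measurable Omega.

Local Notation L2 := (L2 mu Omega).
Local Notation ip := (ip2 mu Omega).
Local Notation nrm := (nrm2 mu Omega).

Variables (ipY : Y -> Y -> R) (S A : (T -> R) -> Y) (Sstar As : Y -> T -> R).
Hypotheses (hipY : inner_product_of ipY)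
  (linS : lin_cont mu Omega S) (linA : lin_cont mu Omega A)
  (adjS : is_adjoint mu Omega ipY S Sstar) (adjA : is_adjoint mu Omega ipY A As).
Variables (U : (T -> R) -> Prop) (P : (T -> R) -> T -> R).
Hypotheses (UL2 : forall q, U q -> L2 q) (convU : is_convex U)
  (hP : is_L2proj mu Omega U P).
Variables (CS B dl : R).
Hypotheses (CS_ge0 : 0 <= CS) (dl_ge0 : 0 <= dl)
  (S_le : forall f, L2 f -> `|S f| <= CS * nrm f)
  (U_le : forall q, U q -> nrm q <= B)
  (A_approx : forall q, U q -> `|A q - S q| <= dl).
Variables (z w : Y).

Let ud := P (Sstar w).

Hypothesis ud_min : forall v, U v -> `|S ud - z| ^+ 2 <= `|S v - z| ^+ 2.

Variables (alpha eps : nat -> R) (u : nat -> T -> R).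
Hypotheses (alpha_gt0 : forall k, (0 < k)%N -> 0 < alpha k)
  (hu : inexact_bregman mu Omega P A As z U alpha eps u).

Lemma ud_in_U : U ud.
Proof. by case: (hP (adjS w).1). Qed.

Lemma B_ge0 : 0 <= B.
Proof. exact: le_trans (nrm2_ge0 _ _ _) (U_le ud_in_U). Qed.

Lemma S_le_U q : U q -> `|S q| <= CS * B.
Proof.
by move=> Uq; apply: (le_trans (S_le (UL2 Uq))); apply: ler_wpM2l => //; exact: U_le.
Qed.

Let Z := `|z| + CS * B + dl.

Lemma residual_le q : U q -> `|z - A q| <= Z.
Proof.
move=> Uq; apply: (le_trans (ler_normB _ _)); rewrite /Z -addrA lerD2l.
have := ler_normD (A q - S q) (S q); rewrite subrK => /le_trans; apply.
by rewrite addrC lerD ?S_le_U ?A_approx.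
Qed.

Lemma optimality_ineq q : U q -> ipY (S q - S ud) (z - S ud) <= 0.
Proof. exact: (min_variational_ineq mOmega hipY linS UL2 convU ud_in_U ud_min). Qed.

Lemma source_ineq q : U q ->
  ipY (S q - S ud) w <= ip ud (fun x => q x - ud x).
Proof.
move=> Uq; have [LSw adjSw] := adjS w; have [Lq Lud] := (UL2 Uq, UL2 ud_in_U).
have := L2proj_variational_ineq mOmega hP UL2 convU LSw Uq.
by rewrite -/ud ip2Bl ?adjSw ?(linB linS Lq Lud) //; try exact: L2B; lra.
Qed.

Lemma u_in_U k : (0 < k)%N -> U (u k).
Proof. by move=> k_gt0; case: (hu.2 k k_gt0). Qed.

(* In the notation of the header, [dual k] is mu_k and [src k] is c_k. *)
Let lam k := lam_in A As z alpha u k.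
Let dual k := \sum_(1 <= i < k.+1) (alpha i)^-1 *: (z - A (u i)).
Let img k := \sum_(1 <= i < k.+1) (alpha i)^-1 *: (S (u i) - S ud).
Let err k := \sum_(1 <= i < k.+1) (alpha i)^-1 *: (A (u i) - S (u i)).
Let src k := w + img k.

Lemma lamS k :
  lam k.+1 = (fun x => (alpha k.+1)^-1 * As (z - A (u k.+1)) x + lam k x).
Proof. by apply: funext => x; rewrite /lam /lam_in big_nat_recr //= addrC. Qed.

Lemma lam_adjoint k :
  L2 (lam k) /\ forall g, L2 g -> ip (lam k) g = ipY (A g) (dual k).
Proof.
have Lud := UL2 ud_in_U.
elim: k => [|k [L_lam lam_ip]].
  have -> : lam 0 = (fun x => ud x - ud x).
    by apply: funext => x; rewrite /lam /lam_in big_geq // subrr.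
  split=> [|g Lg]; first exact: L2B.
  by rewrite ip2Bl // subrr /dual big_geq // (ipYC hipY) (ipY0l hipY).
have [L_As As_ip] := adjA (z - A (u k.+1)).
rewrite lamS; split=> [|g Lg]; first exact: L2_lin.
have -> : dual k.+1 = dual k + (alpha k.+1)^-1 *: (z - A (u k.+1)).
  by rewrite /dual big_nat_recr.
by rewrite ip2_linl // As_ip // lam_ip // [RHS](ipYDr hipY) (ipYZr hipY) addrC.
Qed.

Lemma dual_decomp k : dual k = gam alpha k *: (z - S ud) - img k - err k.
Proof.
rewrite /dual /img /err /gam scaler_suml -!sumrB; apply: eq_bigr => i _.
rewrite -!scalerBr; congr (_ *: _).
by rewrite !opprB !addrA !subrK.
Qed.

Lemma S_sub_le q q' : U q -> U q' -> `|S q - S q'| <= 2 * CS * B.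
Proof.
move=> Uq Uq'; apply: (le_trans (ler_normB _ _)).
by rewrite -mulrA mulr_natl mulr2n; apply: lerD; exact: S_le_U.
Qed.

Lemma srcS k : src k.+1 = src k + (alpha k.+1)^-1 *: (S (u k.+1) - S ud).
Proof. by rewrite /src /img big_nat_recr //= addrA. Qed.

Lemma dual_le k : `|dual k| <= gam alpha k * Z.
Proof. by apply: norm_sum_le_gam => // i /u_in_U; exact: residual_le. Qed.

Lemma err_le k : `|err k| <= gam alpha k * dl.
Proof. by apply: norm_sum_le_gam => // i /u_in_U; exact: A_approx. Qed.

Lemma src_le k : `|src k| <= `|w| + gam alpha k * (2 * CS * B).
Proof.
apply: (le_trans (ler_normD _ _)); rewrite lerD2l.
by apply: norm_sum_le_gam => // i /u_in_U Uui; apply: S_sub_le => //; exact: ud_in_U.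
Qed.

Let plam k := P (lam k).

Lemma plam_estimate k :
  nrm (fun x => plam k x - ud x) ^+ 2 <= ipY (A (plam k) - A ud) (dual k)
    - ipY (S (plam k) - S ud) w - gam alpha k * ipY (S (plam k) - S ud) (z - S ud).
Proof.
have [L_lam lam_ip] := lam_adjoint k.
have Up : U (plam k) by case: (hP L_lam).
have [Lp Lud] := (UL2 Up, UL2 ud_in_U).
have := L2proj_variational_ineq mOmega hP UL2 convU L_lam ud_in_U.
rewrite -/(plam k) ip2Bl //; last exact: L2B.
rewrite lam_ip ?(linB linA Lud Lp) //; last exact: L2B.
rewrite -(opprB (A (plam k))) (ipYNl hipY) => proj_ineq.
have := source_ineq Up; have := mulr_ge0_le0 (gam_ge0 alpha_gt0 k) (optimality_ineq Up).
have := ip2_sub_sym mOmega Lp Lud; lra.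
Qed.

Lemma plam_bound k : (0 < k)%N ->
  nrm (fun x => plam k x - ud x) ^+ 2 <=
    2 * dl * (gam alpha k * Z) + 2 * CS * B * (gam alpha k * dl)
    + CS * nrm (fun x => u k x - plam k x) * (`|w| + gam alpha k * (2 * CS * B))
    - ipY (S (u k) - S ud) (src k).
Proof.
move=> k_gt0; have [L_lam _] := lam_adjoint k.
have Up : U (plam k) by case: (hP L_lam).
have [Uk Uud] := (u_in_U k_gt0, ud_in_U).
set p := plam k; set D := S p - S ud; set E := (A p - S p) - (A ud - S ud).
have splitA : ipY (A p - A ud) (dual k) = ipY E (dual k) + ipY D (dual k).
  by rewrite -(ipYDl hipY) /E /D addrACA subrK opprB addrAC subrr add0r.
have splitD : ipY D (dual k) = gam alpha k * ipY D (z - S ud) - ipY D (img k) - ipY D (err k).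
  by rewrite dual_decomp 2!(ipYBr hipY) (ipYZr hipY).
have splitS : ipY D (src k) = ipY D w + ipY D (img k) by rewrite (ipYDr hipY).
have splitD' : ipY D (src k) = ipY (S p - S (u k)) (src k) + ipY (S (u k) - S ud) (src k).
  by rewrite -(ipYDl hipY) addrA subrK.
have E_le : `|E| <= 2 * dl.
  apply: (le_trans (ler_normB _ _)).
  by rewrite mulr_natl mulr2n; apply: lerD; exact: A_approx.
have Sp_le : `|S p - S (u k)| <= CS * nrm (fun x => u k x - p x).
  by rewrite distrC -(linB linS (UL2 Uk) (UL2 Up)); exact/S_le/(L2B mOmega (UL2 Uk) (UL2 Up)).
have T1 : ipY E (dual k) <= 2 * dl * (gam alpha k * Z).
  by apply: (le_trans (ipY_le_norm hipY _ _)); apply: ler_pM => //; exact: dual_le.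
have T2 : - ipY D (err k) <= 2 * CS * B * (gam alpha k * dl).
  rewrite lerNl; apply: le_trans (ipY_ge_norm hipY _ _); rewrite lerN2.
  by apply: ler_pM => //; [exact: S_sub_le | exact: err_le].
have T3 : - ipY (S p - S (u k)) (src k) <=
    CS * nrm (fun x => u k x - p x) * (`|w| + gam alpha k * (2 * CS * B)).
  rewrite lerNl; apply: le_trans (ipY_ge_norm hipY _ _); rewrite lerN2.
  by apply: ler_pM => //; exact: src_le.
have := plam_estimate k; rewrite -/p -/D; lra.
Qed.

Let C1 := 4 * Z + 4 * CS * B.
Let C2 := 2 * CS * `|w| + 4 * CS ^+ 2 * B + 2.

Lemma C1_ge0 : 0 <= C1.
Proof. by rewrite /C1 /Z addr_ge0 ?mulr_ge0 ?addr_ge0 ?mulr_ge0 ?B_ge0. Qed.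

Lemma C2_ge0 : 0 <= C2.
Proof. by rewrite /C2 !addr_ge0 ?mulr_ge0 ?exprn_ge0 ?B_ge0. Qed.

Lemma step_estimate k :
  (alpha k.+1)^-1 * nrm (fun x => u k.+1 x - ud x) ^+ 2 + `|src k.+1| ^+ 2
  <= `|src k| ^+ 2 + (C1 * Hterm alpha dl k.+1 + C2 * Rterm alpha eps k.+1).
Proof.
have [Uk B_le] := proj2 hu k.+1 (ltn0Sn k).
have [L_lam _] := lam_adjoint k.+1.
have Up : U (plam k.+1) by case: (hP L_lam).
have [[Luk Lp] Lud] := (UL2 Uk, UL2 Up, UL2 ud_in_U).
set a := (alpha k.+1)^-1; set g := gam alpha k.+1.
set eta := nrm (fun x => u k.+1 x - plam k.+1 x).
set e := S (u k.+1) - S ud.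
have a_ge0 : 0 <= a by rewrite invr_ge0 ltW ?alpha_gt0.
have eta_le : (1 + a) * eta <= eps k.+1 by move: B_le; rewrite /Bres /eta /plam lamS.
have [Ra Rg Re] := Rterm_ge alpha_gt0 (nrm2_ge0 _ _ _) eta_le.
have Hg := Hterm_ge alpha_gt0 k dl_ge0.
have src_growth : `|src k.+1| ^+ 2 - `|src k| ^+ 2 <= 2 * a * ipY e (src k.+1).
  by rewrite srcS; exact: normDZ_sq_le.
have u_split : nrm (fun x => u k.+1 x - ud x) ^+ 2
    <= 2 * eta ^+ 2 + 2 * nrm (fun x => plam k.+1 x - ud x) ^+ 2.
  have := nrm2_add_sq_le mOmega (L2B mOmega Luk Lp) (L2B mOmega Lp Lud).
  by congr (_ <= _); congr (_ ^+ 2); congr nrm2; apply: funext => x; rewrite addrA subrK.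
have := ler_wpM2l a_ge0 u_split.
have := ler_wpM2l a_ge0 (plam_bound (ltn0Sn k)); rewrite -/eta -/g -/e.
have := ler_wpM2l C1_ge0 Hg.
have := ler_wpM2l (mulr_ge0 (mulr_ge0 (ler0n _ 2) CS_ge0) (normr_ge0 w)) Ra.
have := ler_wpM2l (mulr_ge0 (mulr_ge0 (ler0n _ 4) (sqr_ge0 CS)) B_ge0) Rg.
have := ler_wpM2l (ler0n _ 2) Re.
rewrite /C1 /C2 -/a -/g -/eta.
set n0 := `|src k| ^+ 2; set n1 := `|src k.+1| ^+ 2; set nw := `|w|.
move: src_growth; rewrite -/n0 -/n1 => src_growth.
lra.
Qed.

Lemma weighted_errors_le k :
  \sum_(1 <= i < k.+1) (alpha i)^-1 * nrm (fun x => u i x - ud x) ^+ 2 + `|src k| ^+ 2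
  <= `|w| ^+ 2 + \sum_(1 <= i < k.+1) (C1 * Hterm alpha dl i + C2 * Rterm alpha eps i).
Proof.
elim: k => [|k IH]; first by rewrite /src /img !big_geq // !addr0 add0r.
rewrite !(big_nat_recr k.+1) //=; have := step_estimate k.
set n0 := `|src k| ^+ 2; set n1 := `|src k.+1| ^+ 2; move: IH; rewrite -/n0; lra.
Qed.

Lemma eps_ge0 k : (0 < k)%N -> 0 <= eps k.
Proof.
move=> k_gt0; have [_ B_le] := proj2 hu k k_gt0; apply: le_trans B_le.
by rewrite mulr_ge0 ?nrm2_ge0 // addr_ge0 // invr_ge0 ltW ?alpha_gt0.
Qed.

Theorem inexact_bregman_estimate : exists c, 0 < c /\ forall k,
  \sum_(1 <= i < k.+1) (alpha i)^-1 * nrm (fun x => u i x - ud x) ^+ 2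
  <= c * (1 + \sum_(1 <= i < k.+1) Rterm alpha eps i
            + \sum_(1 <= i < k.+1) Hterm alpha dl i).
Proof.
have [C1_ge0 C2_ge0] := (C1_ge0, C2_ge0).
set nw := `|w| ^+ 2; have nw_ge0 : 0 <= nw := sqr_ge0 _.
exists (nw + C1 + C2 + 1); split=> [|k]; first lra.
have SR_ge0 := sum_ge0 k (fun i i_gt0 => Rterm_ge0 alpha_gt0 i_gt0 (eps_ge0 i_gt0)).
have SH_ge0 := sum_ge0 k (fun i i_gt0 => Hterm_ge0 alpha_gt0 i_gt0 dl_ge0).
have := weighted_errors_le k; rewrite big_split /= -!mulr_sumr -/nw.
set SR := \sum_(1 <= i < k.+1) Rterm alpha eps i.
set SH := \sum_(1 <= i < k.+1) Hterm alpha dl i.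
have := sqr_ge0 `|src k|; set n := `|src k| ^+ 2.
have : C1 * SH <= (nw + C1 + C2 + 1) * SH by apply: ler_wpM2r => //; lra.
have : C2 * SR <= (nw + C1 + C2 + 1) * SR by apply: ler_wpM2r => //; lra.
lra.
Qed.

End inexact_Bregman_estimate.

Unset Implicit Arguments.
Set Strict Implicit.

Theorem theorem4p1
  (d : measure_display) (T : measurableType d) (R : realType)
  (mu : {measure set T -> \bar R}) (Omega : set T)
  (hOm : measurable Omega) (hOmfin : (mu Omega < +oo)%E)
  (Y : completeNormedModType R) (ipY : Y -> Y -> R)
  (hipY : inner_product_of ipY)
  (S : (T -> R) -> Y) (hS : lin_cont mu Omega S)
  (Sstar : Y -> (T -> R)) (hSstar : is_adjoint mu Omega ipY S Sstar)
  (z : Y) (ua ub : T -> R)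
  (hua : Linf mu Omega ua) (hub : Linf mu Omega ub)
  (hab : {ae mu, forall x, Omega x -> ua x <= ub x})
  (P : (T -> R) -> (T -> R)) (hP : is_L2proj mu Omega (Uad mu Omega ua ub) P)
  (Sh : R -> (T -> R) -> Y) (Shstar : R -> Y -> (T -> R))
  (hSh : forall h, 0 <= h ->
     lin_cont mu Omega (Sh h) /\ is_adjoint mu Omega ipY (Sh h) (Shstar h))
  (hShfin : forall h, 0 < h -> finite_range mu Omega (Sh h))
  (delta : R -> R) (hdelta0 : delta 0 = 0)
  (hdelta_pos : forall h, 0 <= h -> 0 <= delta h)
  (hdelta_mono : forall h1 h2, 0 <= h1 -> h1 <= h2 -> delta h1 <= delta h2)
  (hdelta_cont : {within [set x : R | 0 <= x], continuous delta})
  (hdelta : forall (h : R) (uh : T -> R), 0 <= h -> Uad mu Omega ua ub uh ->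
     `|S uh - Sh h uh|
     + nrm2 mu Omega (fun x => Sstar (Sh h uh - z) x - Shstar h (Sh h uh - z) x)
     <= delta h)
  (alpha : nat -> R) (halpha : forall k, (0 < k)%N -> 0 < alpha k)
  (halpha_bnd : exists M : R, forall k, (0 < k)%N -> alpha k <= M)
  (udag : T -> R)
  (hudag : Uad mu Omega ua ub udag /\
     forall v, Uad mu Omega ua ub v ->
       2^-1 * `|S udag - z| ^+ 2 <= 2^-1 * `|S v - z| ^+ 2)
  (hsource : exists w : Y, {ae mu, forall x, Omega x -> udag x = P (Sstar w) x})
  (eps : nat -> R) (heps : forall k, (0 < k)%N -> 0 < eps k)
  (h : R) (hh : 0 < h)
  (u : nat -> T -> R)
  (hu : inexact_bregman mu Omega P (Sh h) (Shstar h) z (Uad mu Omega ua ub)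
          alpha eps u) :
  exists c : R, 0 < c /\
    forall k : nat,
      \sum_(1 <= i < k.+1) (alpha i)^-1 * (nrm2 mu Omega (fun x => u i x - udag x)) ^+ 2
      <= c * (1 + \sum_(1 <= i < k.+1) Rterm alpha eps i
                + \sum_(1 <= i < k.+1) Hterm alpha (delta h) i).
Proof.
have [linA adjA] := hSh h (ltW hh).
have [CS [CS_ge0 S_le]] := lin_cont_bound hS.
have [B [_ U_le]] := Uad_bounded hOm hua hub hOmfin.
have A_approx q : Uad mu Omega ua ub q -> `|Sh h q - S q| <= delta h.
  move=> Uq; have := hdelta h q (ltW hh) Uq; rewrite distrC.
  by have := nrm2_ge0 mu Omega (fun x => Sstar (Sh h q - z) x - Shstar h (Sh h q - z) x); lra.
have [w udag_ae] := hsource; have [Uudag udag_min] := hudag.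
have Uud : Uad mu Omega ua ub (P (Sstar w)) by case: (hP _ (hSstar w).1).
have S_ud : S udag = S (P (Sstar w)) :=
  lin_cont_ae_eq hOm hS (proj1 Uudag) (proj1 Uud) udag_ae.
have ud_min v : Uad mu Omega ua ub v -> `|S (P (Sstar w)) - z| ^+ 2 <= `|S v - z| ^+ 2.
  by move=> Uv; rewrite -S_ud -(@ler_pM2l _ 2^-1) ?invr_gt0 ?udag_min.
have udag_ud i : (0 < i)%N -> nrm2 mu Omega (fun x => u i x - udag x)
    = nrm2 mu Omega (fun x => u i x - P (Sstar w) x).
  move=> i_gt0; have Lui : L2 mu Omega (u i) by case: (proj2 hu i i_gt0) => [[]].
  apply: (nrm2_ae_eq hOm).
  - exact: proj1 (L2B hOm Lui (proj1 Uudag)).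
  - exact: proj1 (L2B hOm Lui (proj1 Uud)).
  - by move: udag_ae; apply: filterS => x udag_x /udag_x ->.
have [c [c_gt0 c_bound]] := inexact_bregman_estimate hOm hipY hS linA hSstar adjA
  (fun q (Uq : Uad mu Omega ua ub q) => proj1 Uq) (Uad_convex (ua := ua) (ub := ub) hOm)
  hP CS_ge0 (hdelta_pos h (ltW hh)) S_le U_le A_approx ud_min halpha hu.
exists c; split=> // k.
by under eq_big_nat => i /andP[i_gt0 _] do rewrite udag_ud //; exact: c_bound.
Qed.
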